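(* Let $r>0$, $P_0>0$, and consider, for $\epsilon>0$, the Gaussian sequence model $y_j=a_jx_j+\epsilon\sigma_j\xi_j$, $j\ge 1$, described in the context, with the a priori information $x\in B^r_{2\infty}$. Assume that for all $j>1$ $$\frac{\sigma_j^2\, a_{j-1}^2\,\bigl((j-1)^{-2r}-j^{-2r}\bigr)}{\sigma_{j-1}^2\, a_j^2\,\bigl(j^{-2r}-(j+1)^{-2r}\bigr)}>1 .$$ Then the (Tikhonov regularization) estimator $\hat x_\epsilon=\{\lambda_jy_j\}_{j=1}^\infty$ with $$\lambda_j=a_j^{-1}\,\frac{a_j^2P_0\bigl(j^{-2r}-(j+1)^{-2r}\bigr)}{a_j^2P_0\bigl(j^{-2r}-(j+1)^{-2r}\bigr)+\epsilon^2\sigma_j^2},\qquad j\ge 1,$$ is a minimax linear estimator, i.e. $$\sup_{x\in B^r_{2\infty}}E_x\|\hat x_\epsilon-x\|^2=\inf_{\mu}\ \sup_{x\in B^r_{2\infty}}E_x\|\hat x_{\epsilon\mu}-x\|^2,$$ where the infimum is over all real sequences $\mu=\{\mu_j\}_{j=1}^\infty$ and $\hat x_{\epsilon\mu}=\{\mu_jy_j\}_{j=1}^\infty$. Moreover, the minimax linear risk $R_{l\epsilon}$ (the common value of the two sides above) satisfies, as $\epsilon\to0$, $$R_{l\epsilon}=\epsilon^2(1+o(1))\sum_{j=1}^\infty\frac{\sigma_j^2P_0\bigl(j^{-2r}-(j+1)^{-2r}\bigr)}{a_j^2P_0\bigl(j^{-2r}-(j+1)^{-2r}\bigr)+\ep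silon^2\sigma_j^2}.$$
   Context: Setting: $H$ is a separable Hilbert space with inner product $\langle\cdot,\cdot\rangle$ and norm $\|a\|=\langle a,a\rangle^{1/2}$; $A:H\to H$ is a known self-adjoint bounded linear operator with eigenvalues $\{a_i\}_{i=1}^\infty$, $a_i\neq0$, and a corresponding orthonormal basis of eigenvectors $\{\phi_i\}_{i=1}^\infty$. One wishes to estimate the solution $x\in H$ of $f=Ax$ from the observation $Y=f+\epsilon\xi$, where $\xi$ is Gaussian noise and $\epsilon>0$ is the noise level. In coordinates $x_i=\langle x,\phi_i\rangle$, $y_i=\langle Y,\phi_i\rangle$, the observation is the sequence $$y_i=a_ix_i+\epsilon\sigma_i\xi_i,\qquad 1\le i<\infty,$$ where $\sigma_i>0$ are known constants and $\xi_i$ are i.i.d. Gaussian random variables with $E[\xi_i]=0$ and $\mathrm{Var}[\xi_i]=1$. Vectors of $H$ are identified with their coefficient sequences, so $\|x\|^2=\sum_i x_i^2$. $E_x$ denotes expectation when the true solution is $x$. The a priori set is $$B^r_{2\infty}=\Bigl\{\theta=\{\theta_i\}_{i=1}^\infty:\ \sup_{k\ge1}k^{2r}\sum_{i=k}^\infty\theta_i^2\le P_0\Bigr\}.$$ Linear estimators are those of the form $\hat x_{\epsilon\mu}=\{\mu_jy_j\}_{j=1}^\infty$ with $\mu_j\in\mathbb R$ nonrandom (they may depend on $\epsilon$). *)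

(* Defs.v *)
From HB Require Import structures.
From mathcomp Require Import all_boot all_order all_algebra.
From mathcomp Require Import all_classical all_reals all_analysis.

Set Implicit Arguments.
Unset Strict Implicit.
Unset Printing Implicit Defensive.

Import Order.TTheory GRing.Theory Num.Theory.
Import numFieldNormedType.Exports.

Local Open Scope classical_set_scope.
Local Open Scope ring_scope.

(* Sequences indexed by 1, 2, 3, ... in the mathematics are indexed by nat
   here: index [j] stands for the classical index [j.+1], so the classical
   weight j^(-2r) - (j+1)^(-2r) is [weight r j] with [j.+1] and [j.+2]. *)

Section hilbert.
Context (R : realType) (H : completeNormedModType R) (ip : H -> H -> R).

(* [completeNormedModType] provides completeness; the last field says that the
   norm of [H] is the one induced by [ip], which makes [H] a real Hilbert
   space. *)
Record inner_product : Prop := InnerProduct {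
  inner_product_sym : forall u v : H, ip u v = ip v u ;
  inner_product_linear :
    forall (c : R) (u v w : H), ip (c *: u + v) w = c * ip u w + ip v w ;
  inner_product_norm : forall u : H, ip u u = `|u| ^+ 2 }.

Definition bounded_operator (A : {linear H -> H}) : Prop :=
  exists M : R, forall u : H, `|A u| <= M * `|u|.

Definition self_adjoint (A : {linear H -> H}) : Prop :=
  forall u v : H, ip (A u) v = ip u (A v).

Definition coefs (phi : nat -> H) (x : H) : nat -> R := fun i => ip x (phi i).

(* The existence of such a countable basis makes [H] separable. *)
Record orthonormal_basis (phi : nat -> H) : Prop := OrthonormalBasis {
  orthonormal : forall i j : nat, ip (phi i) (phi j) = (i == j)%:R ;
  expansion : forall x : H,
    series (fun i => coefs phi x i *: phi i) n @[n --> \oo] --> x }.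

Lemma coefs_image (A : {linear H -> H}) (phi : nat -> H) (a : nat -> R)
    (x : H) (j : nat) :
  inner_product -> self_adjoint A -> (forall i, A (phi i) = a i *: phi i) ->
  coefs phi (A x) j = a j * coefs phi x j.
Proof.
move=> ipP Asa Aphi; rewrite /coefs Asa Aphi inner_product_sym //.
have ip0 v : ip 0 v = 0.
  have := inner_product_linear ipP 1 0 0 v.
  by rewrite scale1r addr0 mul1r => /eqP; rewrite -subr_eq subrr eq_sym => /eqP.
rewrite -[a j *: _]addr0 (inner_product_linear ipP) ip0 addr0.
by rewrite inner_product_sym.
Qed.

End hilbert.

Section noise.
Context d (T : measurableType d) (R : realType) (P : probability T R).

Definition mutually_independent (X : nat -> {RV P >-> R}) : Prop :=
  forall (s : seq nat) (B : nat -> set R),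
    uniq s -> (forall j, measurable (B j)) ->
    P (\bigcap_(j in [set` s]) (X j @^-1` B j)) =
    (\prod_(j <- s) P (X j @^-1` B j))%E.

Definition identically_distributed (X : nat -> {RV P >-> R}) : Prop :=
  forall (i j : nat) (B : set R), measurable B ->
    distribution P (X i) B = distribution P (X j) B.

(* The second parameter of [normal_prob] is the standard deviation; for the
   value 0 the library's [normal_prob] is a uniform law, hence [0 < s]. *)
Definition gaussian (X : {RV P >-> R}) : Prop :=
  exists m s : R, 0 < s /\
    forall B : set R, measurable B -> distribution P X B = normal_prob m s B.

Record iid_standard_gaussian (X : nat -> {RV P >-> R}) : Prop := IidGaussian {
  iid_independent : mutually_independent X ;
  iid_identical : identically_distributed X ;
  iid_gaussian : forall j, gaussian (X j) ;
  iid_mean : forall j, ('E_P[X j] = 0)%E ;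
  iid_variance : forall j, ('V_P[X j] = 1)%E }.

End noise.

Section sequence_model.
Context (R : realType).

Definition weight (r : R) (j : nat) : R :=
  j.+1%:R `^ (- (2 * r)) - j.+2%:R `^ (- (2 * r)).

Definition B2oo (r P0 : R) : set (nat -> R) :=
  [set theta | (ereal_sup (range (fun k : nat =>
      (k.+1%:R `^ (2 * r))%:E * \sum_(k <= i <oo) (theta i ^+ 2)%:E))
    <= P0%:E)%E].

Definition tikhonov (a sigma : nat -> R) (r P0 eps : R) : nat -> R :=
  fun j => (a j)^-1 *
    ((a j ^+ 2 * P0 * weight r j) /
     (a j ^+ 2 * P0 * weight r j + eps ^+ 2 * sigma j ^+ 2)).

Context (H : completeNormedModType R) (ip : H -> H -> R) (phi : nat -> H).
Context d (T : measurableType d) (P : probability T R).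
Context (xi : nat -> {RV P >-> R}) (a sigma : nat -> R).

(* By [coefs_image], the first term is the coordinate <A x, phi_j>. *)
Definition observation (eps : R) (x : H) (j : nat) (w : T) : R :=
  a j * coefs ip phi x j + eps * sigma j * xi j w.

Local Open Scope ereal_scope.

(* The loss is the squared l2-distance between coefficient sequences. It is
   extended-real-valued, since {mu_j y_j} need not be square summable. *)
Definition risk (eps : R) (mu : nat -> R) (x : H) : \bar R :=
  \int[P]_w \sum_(j <oo)
    ((mu j * observation eps x j w - coefs ip phi x j) ^+ 2)%:E.

Definition max_risk (r P0 eps : R) (mu : nat -> R) : \bar R :=
  ereal_sup [set risk eps mu x | x in [set x | B2oo r P0 (coefs ip phi x)]].

Definition minimax_linear_risk (r P0 eps : R) : \bar R :=
  ereal_inf (range (max_risk r P0 eps)).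

End sequence_model.

(* Main.v *)
(** By Tonelli, the risk of [mu] at [x] is the sum over [j] of
    [(mu_j a_j - 1)^2 x_j^2 + (eps sigma_j mu_j)^2].  The extremal sequence is
    [x_j^2 = P0 * weight r j], whose tails saturate every constraint of [B2oo].
    Its truncations lie in [B2oo], so minimising each term over [mu_j] bounds
    every maximal risk from below, and [tikhonov] attains the termwise minimum.
    Conversely the ratio condition says exactly that the squared bias factors
    [(lambda_j a_j - 1)^2] increase with [j], so by Abel summation the bias of
    [tikhonov] is controlled by the tails of [x_j^2], hence is largest at the
    extremal sequence.  The resulting formula for the risk is exact for each
    [eps]: the [o(1)] term vanishes. *)

Require Import Defs.
From HB Require Import structures.
From mathcomp Require Import all_boot all_order all_algebra.
From mathcomp Require Import all_classical all_reals all_analysis.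
From mathcomp Require Import measurable_realfun ring lra.

Import Order.TTheory GRing.Theory Num.Theory.
Import numFieldNormedType.Exports.

Local Open Scope classical_set_scope.
Local Open Scope ring_scope.

(** * Telescoping weights and comparison of tail sums *)

Lemma weight_gt0 (R : realType) (r : R) (j : nat) : 0 < r -> 0 < weight r j.
Proof.
move=> r0; rewrite /weight subr_gt0 !powRN ltf_pV2 ?posrE ?powR_gt0//.
by rewrite gt0_ltr_powR ?mulr_gt0// ?nnegrE// ltr_nat.
Qed.

(** The sequence is [harmonic n] raised to the power [s], and a positive power tends to 0 as its
    base decreases to 0. *)
Lemma cvg_powRN_succ (R : realType) (s : R) : 0 < s ->
  (n.+1%:R : R) `^ (- s) @[n --> \oo] --> (0 : R).
Proof.
move=> s0.
have -> : (fun n => (n.+1%:R : R) `^ (- s)) = (fun n => harmonic n `^ s).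
  apply/funext => n.
  by rewrite /harmonic -[X in X `^ s]powR_inv1// -powRrM mulN1r.
move/cvg_at_rightP : (powR_cvg0 s0); apply; split; last exact: cvg_harmonic.
by move=> n; rewrite /harmonic invr_gt0.
Qed.

Lemma sum_weight (R : realType) (r : R) (k n : nat) : (k <= n)%N ->
  \sum_(k <= i < n) weight r i =
  (k.+1%:R : R) `^ (- (2 * r)) - n.+1%:R `^ (- (2 * r)).
Proof.
move=> kn.
rewrite (telescope_sumr_eq (fun i => - (i.+1%:R : R) `^ (- (2 * r))))//.
  by rewrite opprK addrC.
by move=> i _; rewrite /weight opprK addrC.
Qed.

Lemma nneseries_weight (R : realType) (r : R) (k : nat) : 0 < r ->
  (\sum_(k <= i <oo) (weight r i)%:E = ((k.+1%:R : R) `^ (- (2 * r)))%:E)%E.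
Proof.
move=> r0; apply/cvg_lim => //.
rewrite -[X in _ --> X%:E]subr0.
apply: (@cvg_trans _
  ((((k.+1%:R : R) `^ (- (2 * r)) - n.+1%:R `^ (- (2 * r)))%:E) @[n --> \oo])).
  apply: near_eq_cvg; near=> n.
  by rewrite sumEFin sum_weight//; near: n; exact: nbhs_infty_ge.
apply/fine_cvgP; split; first by near=> n.
apply: cvgB; first exact: cvg_cst.
by apply: cvg_powRN_succ; rewrite mulr_gt0.
Unshelve. all: by end_near. Qed.

Lemma B2oo_tail (R : realType) (r P0 : R) (theta : nat -> R) (k : nat) :
  B2oo r P0 theta ->
  (\sum_(k <= i <oo) (theta i ^+ 2)%:E <=
   (P0 * (k.+1%:R : R) `^ (- (2 * r)))%:E)%E.
Proof.
move=> B; rewrite EFinM powRN lee_pdivlMr ?powR_gt0// muleC.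
by apply: le_trans B; apply: ereal_sup_ubound; exists k.
Qed.

(* Abel summation: [c j] is the sum of its nonnegative increments up to [j], so
   exchanging the two sums only involves the tails of [u] and [v]. *)
Lemma le_nneseries_tails (R : realType) (c u v : nat -> R) :
  0 <= c 0%N -> nondecreasing_seq c ->
  (forall j, 0 <= u j) -> (forall j, 0 <= v j) ->
  (forall k, \sum_(k <= j <oo) (u j)%:E <= \sum_(k <= j <oo) (v j)%:E)%E ->
  (\sum_(j <oo) (c j * u j)%:E <= \sum_(j <oo) (c j * v j)%:E)%E.
Proof.
move=> c0 cnd u0 v0 uv.
pose D k : R := if k is i.+1 then c i.+1 - c i else c 0%N.
have D0 k : 0 <= D k by case: k => //= k; rewrite subr_ge0 cnd.
have cE j : c j = \sum_(0 <= k < j.+1) D k.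
  rewrite big_nat_recl//= (telescope_sumr_eq c)//.
  by rewrite addrC subrK.
have abel (w : nat -> R) : (forall j, 0 <= w j) ->
    (\sum_(j <oo) (c j * w j)%:E =
    \sum_(k <oo) (D k)%:E * \sum_(k <= j <oo) (w j)%:E)%E.
  move=> w0.
  (* The triangle [k <= j] is padded with zeros to the full quadrant, so that the two nonnegative
     sums can be interchanged. *)
  transitivity (\sum_(j <oo) \sum_(k <oo)
     if (k <= j)%N then (D k * w j)%:E else 0)%E.
    apply: eq_eseriesr => j _; rewrite (nneseries_split 0 j.+1); last first.
      by move=> k _; case: ifP; rewrite // lee_fin mulr_ge0.
    rewrite add0n [X in (_ + X)%E]eseries0 ?adde0; last first.
      by move=> i ji _; rewrite leqNgt ji.
    rewrite cE mulr_suml -sumEFin; apply: eq_big_nat => i /andP[_].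
    by rewrite ltnS => ->.
  rewrite nneseries_interchange; last first.
    by move=> j k; case: ifP; rewrite // lee_fin mulr_ge0.
  apply: eq_eseriesr => k _.
  rewrite -nneseriesZl; last by move=> j _; rewrite lee_fin.
  rewrite -eseries_mkcond [RHS]eseries_cond.
  by apply: eq_eseriesr => j _; rewrite EFinM.
rewrite !abel//; apply: lee_nneseries => [k _ _|k _].
  by rewrite mule_ge0 ?lee_fin// nneseries_ge0// => j _ _; rewrite lee_fin.
by rewrite lee_wpmul2l ?lee_fin.
Qed.

(** * Second moments of standardized noise *)

Section second_moment.
Context d (T : measurableType d) (R : realType) (P : probability T R).
Context (X : {RV P >-> R}).
Hypotheses (EX : ('E_P[X] = 0)%E) (VX : ('V_P[X] = 1)%E).

Lemma integral_sqr_standardized : (\int[P]_w (X w ^+ 2)%:E = 1)%E.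
Proof.
rewrite -VX /variance unlock EX /= unlock.
by apply: eq_integral => w _; rewrite /= !fctE /= !subr0 expr2.
Qed.

Lemma integrable_sqr_standardized :
  P.-integrable setT (fun w => (X w ^+ 2)%:E).
Proof.
apply/integrableP; split.
  by apply/measurable_EFinP; exact: measurable_funX.
under eq_integral do rewrite gee0_abs ?lee_fin ?sqr_ge0//.
by rewrite integral_sqr_standardized ltry.
Qed.

Lemma integrable_standardized : P.-integrable setT (EFin \o X).
Proof.
apply: (@le_integrable _ _ _ P _ measurableT _ (fun w => (1 + X w ^+ 2)%:E)).
- by apply/measurable_EFinP.
- move=> w _ /=; rewrite lee_fin [leRHS]ger0_norm ?addr_ge0 ?sqr_ge0//.
  (* Expanding this square gives [2|X| <= 1 + X^2], hence the domination of [|X|]. *)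
  have := sqr_ge0 (`|X w| - 1).
  rewrite sqrrB real_normK ?num_real// mulr1 expr1n.
  by have := normr_ge0 (X w); lra.
- under eq_fun do rewrite EFinD.
  apply: integrableD => //; last exact: integrable_sqr_standardized.
  exact: finite_measure_integrable_cst.
Qed.

(** Squared bias plus variance: the cross term vanishes because [X] has mean 0. *)
Lemma integral_sqr_affine (u v : R) :
  (\int[P]_w ((u + v * X w) ^+ 2)%:E = (u ^+ 2 + v ^+ 2)%:E)%E.
Proof.
have iX := integrable_standardized.
have iX2 := integrable_sqr_standardized.
under eq_integral => w _.
  have -> : (u + v * X w) ^+ 2 =
    u ^+ 2 + ((u * v *+ 2) * X w + v ^+ 2 * X w ^+ 2) by ring.
  rewrite 2!EFinD 2!EFinM; over.
have i1 : P.-integrable setT (fun w => (u * v *+ 2)%:E * (X w)%:E)%E.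
  exact: (integrableZl _ _ iX).
have i2 : P.-integrable setT (fun w => (v ^+ 2)%:E * (X w ^+ 2)%:E)%E.
  exact: (integrableZl _ _ iX2).
rewrite integralD//; [|exact: finite_measure_integrable_cst|exact: integrableD].
rewrite (integralD _ i1 i2)// integral_cst//.
rewrite [X in (_ * X + _)%E](_ : _ = 1%E); last exact: probability_setT.
rewrite (integralZl _ iX)// (integralZl _ iX2)// integral_sqr_standardized.
have -> : (\int[P]_x (EFin \o X) x = 0)%E by rewrite -EX unlock.
by rewrite mule0 add0e !mule1 EFinD.
Qed.

End second_moment.

(** * Membership in [B2oo] and finitely supported vectors *)

Lemma B2oo_of_le_weight (R : realType) (r P0 : R) (theta : nat -> R) :
  0 < r -> 0 <= P0 -> (forall j, theta j ^+ 2 <= P0 * weight r j) ->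
  B2oo r P0 theta.
Proof.
move=> r0 P00 le_theta; apply: ge_ereal_sup => _ [k _ <-].
have p0 : 0 < (k.+1%:R : R) `^ (2 * r) by rewrite powR_gt0.
(* Dividing by the power turns its inverse into the tail sum of the weights, which leaves a termwise
   comparison. *)
rewrite muleC -lee_pdivlMr// -powRN -nneseries_weight//.
rewrite -nneseriesZl; last by move=> i _; rewrite lee_fin ltW ?weight_gt0.
apply: lee_nneseries => i *; first by rewrite lee_fin sqr_ge0.
by rewrite -EFinM lee_fin.
Qed.

Section coordinates.
Context {R : realType} {H : completeNormedModType R} {ip : H -> H -> R}.
Context {phi : nat -> H}.
Hypotheses (ipP : inner_product ip) (phiP : orthonormal_basis ip phi).

(** This realizes truncated coefficient sequences by actual vectors of [H]. *)
Lemma coefs_sum (t : nat -> R) (n j : nat) :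
  coefs ip phi (\sum_(i < n) t i *: phi i) j = if (j < n)%N then t j else 0.
Proof.
have ip0 v : ip 0 v = 0.
  have := inner_product_linear ipP 1 0 0 v.
  by rewrite scale1r addr0 mul1r => /eqP; rewrite -subr_eq subrr eq_sym => /eqP.
elim: n => [|n IHn]; first by rewrite big_ord0 /coefs ip0.
rewrite big_ord_recr/= addrC /coefs (inner_product_linear ipP).
rewrite -[ip (\sum_(_ < _) _) _]/(coefs ip phi _ j) IHn (Defs.orthonormal phiP).
rewrite ltnS; case: ltngtP => [||->]; rewrite ?mulr0 ?add0r//.
by rewrite mulr1 addr0.
Qed.

End coordinates.

(** * Risk of a linear estimator, coordinate by coordinate *)

Section linear_risk.
Context {R : realType} {H : completeNormedModType R} {ip : H -> H -> R}.
Context {phi : nat -> H}.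
Hypotheses (ipP : inner_product ip) (phiP : orthonormal_basis ip phi).
Context {d : measure_display} {T : measurableType d} {P : probability T R}.
Context {xi : nat -> {RV P >-> R}}.
Hypothesis xiP : iid_standard_gaussian xi.
Context {a sigma : nat -> R}.

Lemma risk_series (eps : R) (mu : nat -> R) (x : H) :
  risk ip phi xi a sigma eps mu x =
  (\sum_(j <oo) ((mu j * a j - 1) ^+ 2 * coefs ip phi x j ^+ 2 +
                 (eps * sigma j * mu j) ^+ 2)%:E)%E.
Proof.
rewrite /risk; set z := coefs ip phi x.
have lossE j w : mu j * observation ip phi xi a sigma eps x j w - z j =
    (mu j * a j - 1) * z j + (eps * sigma j * mu j) * xi j w.
  by rewrite /observation -/z; ring.
rewrite integral_nneseries//=; first last.
- by move=> j w _; rewrite lee_fin sqr_ge0.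
- move=> j; apply/measurable_EFinP/measurable_funX.
  under eq_fun do rewrite lossE.
  by apply: measurable_funD => //; exact: measurable_funM.
apply: eq_eseriesr => j _; under eq_integral do rewrite lossE.
rewrite integral_sqr_affine ?exprMn//; first exact: (iid_mean xiP).
exact: (iid_variance xiP).
Qed.

Context {r P0 eps : R}.
Hypotheses (r_gt0 : 0 < r) (P0_gt0 : 0 < P0) (eps_gt0 : 0 < eps).
Hypotheses (a_neq0 : forall j, a j != 0) (sigma_gt0 : forall j, 0 < sigma j).

(** [b j] is the squared extremal coordinate, and [t j] the least risk in coordinate [j] when
    [x_j^2 = b j]; here [t j] includes the factor [eps ^+ 2]. *)
Local Notation b j := (P0 * weight r j).
Local Notation D j :=
  (a j ^+ 2 * P0 * weight r j + eps ^+ 2 * sigma j ^+ 2).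
Local Notation t j := (eps ^+ 2 * (sigma j ^+ 2 * P0 * weight r j / D j)).

Let w_gt0 j : 0 < weight r j. Proof. exact: weight_gt0. Qed.

Let a2_gt0 j : 0 < a j ^+ 2. Proof. by rewrite exprn_even_gt0//= a_neq0. Qed.

Let s2_gt0 j : 0 < sigma j ^+ 2. Proof. exact: exprn_gt0. Qed.

Let e2_gt0 : 0 < eps ^+ 2. Proof. exact: exprn_gt0. Qed.

Let D_gt0 j : 0 < D j.
Proof.
by apply: addr_gt0; [do 2 apply: mulr_gt0 => // | exact: mulr_gt0].
Qed.

(** The right side is a quadratic in [mu] with leading coefficient [D j]; its minimum [t j] is
    reached at [mu = a j * b j / D j], which is [tikhonov]. *)
Lemma coordinate_risk_ge (mu : R) (j : nat) :
  t j <= (mu * a j - 1) ^+ 2 * b j + (eps * sigma j * mu) ^+ 2.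
Proof.
rewrite mulrA ler_pdivrMr//.
(* The difference of the two sides, times [D j], is this square. *)
have := sqr_ge0 (mu * D j - a j * b j).
by rewrite -subr_ge0 => h; rewrite -subr_ge0; apply: le_trans h _; lra.
Qed.

Lemma coordinate_risk_tikhonov (j : nat) :
  (tikhonov a sigma r P0 eps j * a j - 1) ^+ 2 * b j +
  (eps * sigma j * tikhonov a sigma r P0 eps j) ^+ 2 = t j.
Proof.
by rewrite /tikhonov; field; rewrite a_neq0 exprMn gt_eqF ?D_gt0.
Qed.

(** * Lower bound for every linear estimator *)

Lemma max_risk_ge (mu : nat -> R) :
  (\sum_(j <oo) (t j)%:E <= max_risk ip phi xi a sigma r P0 eps mu)%E.
Proof.
apply: lime_le.
  apply: is_cvg_nneseries => j _ _; rewrite lee_fin mulr_ge0 ?sqr_ge0//.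
  by rewrite divr_ge0 ?(ltW (D_gt0 j))// !mulr_ge0 ?ltW.
apply: nearW => n.
(* The extremal sequence cut after [n] coordinates tests the [n]-th partial sum. *)
pose x := \sum_(i < n) Num.sqrt (b i) *: phi i.
have xE j : coefs ip phi x j ^+ 2 = if (j < n)%N then b j else 0.
  rewrite /x (coefs_sum ipP phiP (fun i => Num.sqrt (b i))).
  by case: ifP => _; rewrite ?expr0n// sqr_sqrtr// mulr_ge0 ?ltW.
apply: (@le_trans _ _ (risk ip phi xi a sigma eps mu x)); last first.
  apply: ereal_sup_ubound; exists x => //=.
  apply: B2oo_of_le_weight; rewrite ?ltW// => j; rewrite xE.
  by case: ifP => // _; rewrite mulr_ge0 ?ltW.
(* The coordinates from [n] on contribute nonnegative terms and are dropped. *)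
rewrite risk_series; apply: le_trans; last first.
  apply: (nneseries_lim_ge n) => j _ _.
  by rewrite lee_fin addr_ge0 ?sqr_ge0// mulr_ge0 ?sqr_ge0.
rewrite !big_mkord; apply: lee_sum => j _.
by rewrite lee_fin xE ltn_ord coordinate_risk_ge.
Qed.

(** * Upper bound for the Tikhonov estimator *)

Hypothesis ratio_gt1 : forall j : nat,
  (sigma j.+1 ^+ 2 * a j ^+ 2 * weight r j) /
  (sigma j ^+ 2 * a j.+1 ^+ 2 * weight r j.+1) > 1.

Lemma tikhonov_bias_nondecreasing :
  nondecreasing_seq (fun j => (tikhonov a sigma r P0 eps j * a j - 1) ^+ 2).
Proof.
have biasE j : (tikhonov a sigma r P0 eps j * a j - 1) ^+ 2 =
    (eps ^+ 2 * sigma j ^+ 2 / D j) ^+ 2.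
  by rewrite /tikhonov; field; rewrite a_neq0 exprMn gt_eqF ?D_gt0.
apply/nondecreasing_seqP => j; rewrite !biasE.
have g0 i : 0 <= eps ^+ 2 * sigma i ^+ 2 / D i.
  by rewrite divr_ge0 ?mulr_ge0 ?sqr_ge0// ltW.
rewrite ler_sqr ?nnegrE// ler_pdivrMr// [leRHS]mulrAC ler_pdivlMr//.
(* After cross-multiplication the [eps ^+ 4] terms cancel; what remains is the ratio condition times
   [eps ^+ 2 * P0]. *)
have := ratio_gt1 j; rewrite ltr_pdivlMr ?mul1r; last first.
  by do 2 apply: mulr_gt0 => //.
by rewrite -(ltr_pM2l (mulr_gt0 e2_gt0 P0_gt0)); nra.
Qed.

Lemma max_risk_tikhonov_le :
  (max_risk ip phi xi a sigma r P0 eps (tikhonov a sigma r P0 eps) <=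
   \sum_(j <oo) (t j)%:E)%E.
Proof.
apply: ge_ereal_sup => _ [x xB <-]; rewrite risk_series.
(* The target becomes the risk series of [tikhonov] with [x_j^2] replaced by [b j]; the variance
   parts then agree and only the biases are compared. *)
rewrite -(eq_eseriesr (fun j _ => congr1 EFin (coordinate_risk_tikhonov j))).
have ge0 (u v : nat -> R) : (forall j, 0 <= v j) ->
    forall j, (0 <= j)%N -> true -> (0 <= (u j ^+ 2 * v j)%:E)%E.
  by move=> v0 j _ _; rewrite lee_fin mulr_ge0 ?sqr_ge0.
have x2_ge0 j : 0 <= coefs ip phi x j ^+ 2 by exact: sqr_ge0.
have b_ge0 j : 0 <= b j by rewrite mulr_ge0 ?ltW.
under [leRHS]eq_eseriesr do rewrite EFinD.
under [leLHS]eq_eseriesr do rewrite EFinD.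
rewrite !nneseriesD;
  do ?by [exact: ge0 | move=> j _ _; rewrite lee_fin sqr_ge0].
apply: leeD => //; apply: le_nneseries_tails => [||j|j|k].
- exact: sqr_ge0.
- exact: tikhonov_bias_nondecreasing.
- exact: x2_ge0.
- exact: b_ge0.
- under [leRHS]eq_eseriesr => j _ do rewrite EFinM.
  rewrite nneseriesZl; last by move=> j _; rewrite lee_fin ltW.
  by rewrite nneseries_weight// -EFinM B2oo_tail.
Qed.

End linear_risk.

(** * Minimax identity and exact risk formula *)

Theorem theorem2p1 (R : realType)
    (H : completeNormedModType R) (ip : H -> H -> R) (ipP : inner_product ip)
    (A : {linear H -> H}) (A_bounded : bounded_operator A)
    (A_sa : self_adjoint ip A)
    (phi : nat -> H) (phiP : orthonormal_basis ip phi)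
    (a : nat -> R) (a_neq0 : forall j, a j != 0)
    (A_phi : forall j, A (phi j) = a j *: phi j)
    (sigma : nat -> R) (sigma_gt0 : forall j, 0 < sigma j)
    (d : measure_display) (T : measurableType d) (P : probability T R)
    (xi : nat -> {RV P >-> R}) (xiP : iid_standard_gaussian xi)
    (r P0 : R) (r_gt0 : 0 < r) (P0_gt0 : 0 < P0)
    (ratio_gt1 : forall j : nat,
      (sigma j.+1 ^+ 2 * a j ^+ 2 * weight r j) /
      (sigma j ^+ 2 * a j.+1 ^+ 2 * weight r j.+1) > 1) :
  (forall eps : R, 0 < eps ->
    max_risk ip phi xi a sigma r P0 eps (tikhonov a sigma r P0 eps) =
    minimax_linear_risk ip phi xi a sigma r P0 eps) /\
  (exists2 o : R -> R, o eps @[eps --> 0^'+] --> (0 : R) &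
    \forall eps \near (0 : R)^'+,
      minimax_linear_risk ip phi xi a sigma r P0 eps =
      ((eps ^+ 2 * (1 + o eps))%:E *
       \sum_(j <oo)
         ((sigma j ^+ 2 * P0 * weight r j) /
          (a j ^+ 2 * P0 * weight r j + eps ^+ 2 * sigma j ^+ 2))%:E)%E).
Proof.
(* Here the factor [eps ^+ 2] is left out, to be pulled out of the series at the end. *)
pose t (eps : R) j := (sigma j ^+ 2 * P0 * weight r j) /
  (a j ^+ 2 * P0 * weight r j + eps ^+ 2 * sigma j ^+ 2).
have minimaxE eps : 0 < eps ->
    max_risk ip phi xi a sigma r P0 eps (tikhonov a sigma r P0 eps) =
      (\sum_(j <oo) (eps ^+ 2 * t eps j)%:E)%E /\
    minimax_linear_risk ip phi xi a sigma r P0 eps =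
      (\sum_(j <oo) (eps ^+ 2 * t eps j)%:E)%E.
  move=> e0; have le_tik := max_risk_tikhonov_le (ip := ip) (phi := phi)
    xiP r_gt0 P0_gt0 e0 a_neq0 sigma_gt0 ratio_gt1.
  have ge_S := max_risk_ge ipP phiP xiP r_gt0 P0_gt0 e0 a_neq0 sigma_gt0.
  (* The infimum lies between the common lower bound and the maximal risk of [tikhonov], and both
     equal the series. *)
  split; apply: le_anti; apply/andP; split; [exact: le_tik|exact: ge_S| |].
    apply: le_trans le_tik; apply: ereal_inf_lbound.
    by exists (tikhonov a sigma r P0 eps).
  by apply: le_ereal_inf_tmp => _ [mu _ <-]; exact: ge_S.
split=> [eps /minimaxE[-> ->]//|].
exists (cst 0); first exact: cvg_cst.
near=> eps; have e0 : 0 < eps by [].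
have [_ ->] := minimaxE _ e0.
rewrite addr0 mulr1 -nneseriesZl// => j _; rewrite lee_fin.
have w_ge0 : 0 <= weight r j by rewrite ltW ?weight_gt0.
have P0_ge0 := ltW P0_gt0.
by apply: divr_ge0; [|apply: addr_ge0];
  do 3?[exact: sqr_ge0 | exact: w_ge0 | exact: P0_ge0 | apply: mulr_ge0].
Unshelve. all: by end_near. Qed.
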